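(* Consider the Retrospective Approximation (RA) iterates $\{X_k,k\ge1\}$ with sample sizes $\{M_k\}$ and error tolerances $\{\epsilon_k\}$, as described in the context. Let $\alpha\in(0,1)$ and $\delta_0>0$, and define the empirical-mean envelope of the weighted relative error class $$H_m:=\sup_{x\in\mathbb{R}^d}\|R_m(x)\|\left(\|\nabla f(x)\|^\alpha+\delta_0\right).$$ Suppose there exists $\sigma_0<\infty$ such that for every $k$, $$\mathbb{E}\left[\left(\sqrt{M_k}\,H_{M_k}\right)^{1/\alpha}\mid\mathcal{F}_{k-1}\right]\le\sigma_0^{1/\alpha}.$$ Suppose that for some $p>0$ and each $k\ge1$, $\epsilon_k=C_{2,k}/M_k^{p}$, where $C_{2,k}$ is $\mathcal{F}_{k-1}$-measurable and $C_{2,k}\le c_2$ for a constant $c_2$. Let $$\kappa_2:=2(1-\alpha)\left(\frac{2\alpha}{1-\alpha}\right)^{\alpha}\sigma_0 .$$ Then for every $k\ge2$, $$\mathbb{E}\left[\|\nabla f(X_k)\|\mid\mathcal{F}_{k-1}\right]\le\frac{2c_2}{M_k^p}+\frac{2c_0\sigma_0/\delta_0}{\sqrt{M_k}}+\left(\frac{\kappa_2}{\sqrt{M_k}}\right)^{1/\alpha}.$$ If, moreover, $p=1/2$, $M_1=m_1$ is a positive constant and, for $k\ge2$, $M_k=C_{1,k}M_{k-1}$ with $C_{1,k}$ being $\mathcal{F}_{k-1}$-measurable and $C_{1,k}\ge c_1$ for a constant $c_1>1$, then for every $k\ge2$, $$\mathbb{E}\left[\|\nabla f(X_k)\|\ri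ght]\le\left(\frac1{\sqrt{c_1}}\right)^{k-1}\left(\frac{2(c_2+c_0\sigma_0/\delta_0)}{\sqrt{m_1}}+\left(\frac{\kappa_2}{\sqrt{m_1}}\right)^{1/\alpha}\right).$$
   Context: Problem: minimize $f(x):=\mathbb{E}[F(x,Y)]$ over $x\in\mathbb{R}^d$, where $Y$ is a random variable with distribution $P$ on a measurable space $(\mathcal{Y},\mathcal{A})$, $F(\cdot,y)$ is a smooth function on $\mathbb{R}^d$ for every $y\in\mathcal{Y}$ with gradient $\nabla F(\cdot,y)$, and $\mathbb{E}[\nabla F(x,Y)]=\nabla f(x)$ for all $x$. $\|\cdot\|$ is the Euclidean norm. Sampling: $\{\tilde Y_j, j\ge1\}$ is an IID sequence of copies of $Y$. $M_1$ is a constant positive integer, $\mathcal{F}_0$ is trivial, $\mathcal{F}_k:=\sigma(\tilde Y_j: j\le \sum_{i=1}^k M_i)$, and the (positive-integer-valued) sample size $M_{k+1}$ is $\mathcal{F}_k$-measurable. At iteration $k$ the sample-path function and gradient are $$f_{M_k}(x):=\frac1{M_k}\sum_{j=1}^{M_k}F(x,Y_j),\qquad \nabla f_{M_k}(x):=\frac1{M_k}\sum_{j=1}^{M_k}\nabla F(x,Y_j),\qquad Y_j:=\tilde Y_{(\sum_{i=1}^{k-1}M_i)+j}.$$ RA algorithm: start from an initial guess $X_0$. At each outer iteration $k\ge1$, choose $M_k$ and a tolerance $\epsilon_k\ge0$, both $\mathcal{F}_{k-1}$-measurable; starting at $X_{k-1}$, run an iterative deterministic solver on the problem of minimizing $f_{M_k}$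 over $\mathbb{R}^d$ until it produces a point $X_k$ with $\|\nabla f_{M_k}(X_k)\|\le\epsilon_k$. (It is assumed that the solver can always produce such a point.) Thus $X_k$ is $\mathcal{F}_k$-measurable. Relative error: fix $c_0>0$. $R(x,Y):=\frac{\nabla F(x,Y)-\nabla f(x)}{\|\nabla f(x)\|+c_0}$, and the weighted relative error class is $\{R(x,Y)(\|\nabla f(x)\|^\alpha+\delta_0):x\in\mathbb{R}^d\}$. For $m\ge1$, $R_m(x):=\frac{\nabla f_m(x)-\nabla f(x)}{\|\nabla f(x)\|+c_0}$ with $\nabla f_m(x)=\frac1m\sum_{j=1}^m\nabla F(x,Y_j)$ and $Y_1,Y_2,\dots$ IID copies of $Y$. $R_{M_k}$ and $H_{M_k}$ denote these quantities formed with $\nabla f_{M_k}$, i.e. with the iteration-$k$ sample. *)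

(* Defs.v *)
From HB Require Import structures.
From mathcomp Require Import all_boot all_order all_algebra.
From mathcomp Require Import all_classical all_reals all_analysis.
From mathcomp Require Import measurable_realfun.

Set Implicit Arguments.
Unset Strict Implicit.
Unset Printing Implicit Defensive.

Import Order.TTheory GRing.Theory Num.Theory.
Import numFieldNormedType.Exports.

Local Open Scope classical_set_scope.
Local Open Scope ring_scope.

(* The norm [`|v|] of the library on ['rV[R]_d] is the sup norm. *)
Definition enorm (R : realType) (d : nat) (v : 'rV[R]_d) : R :=
  Num.sqrt (\sum_(i < d) v 0 i ^+ 2).

Definition grad (R : realType) (d : nat) (g : 'rV[R]_d -> R) (x : 'rV[R]_d) :
    'rV[R]_d :=
  \row_(i < d) 'D_(delta_mx 0 i) g x.

Definition smooth (R : realType) (d : nat) (g : 'rV[R]_d -> R) : Prop :=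
  (forall x, differentiable g x) /\ continuous (grad g).

(* [G] is a sigma-algebra on [T], in general smaller than the one carried by
   the type [T]. *)
Definition measurable_wrt (T : Type) (d' : measure_display)
    (T' : measurableType d') (G : set (set T)) (h : T -> T') : Prop :=
  forall B : set T', measurable B -> G (h @^-1` B).

(* [C] is a version of E[Z | G], for a nonnegative random variable [Z] that
   need not be integrable or finite. *)
Definition is_cond_exp (R : realType) (d : measure_display)
    (T : measurableType d) (P : probability T R) (G : set (set T))
    (Z C : T -> \bar R) : Prop :=
  [/\ measurable_fun setT Z,
      measurable_wrt G C,
      forall w, (0 <= C w)%E &
      forall A, G A -> (\int[P]_(w in A) C w = \int[P]_(w in A) Z w)%E].

(* E[Z | G] <= B almost surely. Versions of E[Z | G] exist and agree almost
   surely; existence is required here so that the bound is never vacuous. *)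
Definition cond_exp_le (R : realType) (d : measure_display)
    (T : measurableType d) (P : probability T R) (G : set (set T))
    (Z B : T -> \bar R) : Prop :=
  (exists C, is_cond_exp P G Z C) /\
  (forall C, is_cond_exp P G Z C -> {ae P, forall w, (C w <= B w)%E}).

Definition iid_copies (R : realType) (d dY : measure_display)
    (T : measurableType d) (Ysp : measurableType dY) (P : probability T R)
    (PY : probability Ysp R) (Yt : nat -> {RV P >-> Ysp}) : Prop :=
  (forall j B, measurable B -> distribution P (Yt j) B = PY B) /\
  (forall (n : nat) (B : nat -> set Ysp), (forall j, measurable (B j)) ->
     P (\bigcap_(j in `I_n) (Yt j @^-1` B j)) =
     (\prod_(j < n) P (Yt j @^-1` B j))%E).

Definition objective (R : realType) (dY : measure_display)
    (Ysp : measurableType dY) (PY : probability Ysp R) (d : nat)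
    (F : 'rV[R]_d -> Ysp -> R) (x : 'rV[R]_d) : R :=
  \int[PY]_y F x y.

(* The integrability conditions say that E[F(x, Y)] and E[grad F(x, Y)] make
   sense. *)
Record unbiased_oracle (R : realType) (dY : measure_display)
    (Ysp : measurableType dY) (PY : probability Ysp R) (d : nat)
    (F : 'rV[R]_d -> Ysp -> R) : Prop := {
  oracle_smooth : forall y, smooth (F ^~ y) ;
  oracle_integrable : forall x, PY.-integrable setT (EFin \o F x) ;
  objective_differentiable : forall x, differentiable (objective PY F) x ;
  oracle_grad_integrable : forall x i,
    PY.-integrable setT (fun y => (grad (F ^~ y) x 0 i)%:E) ;
  oracle_grad_unbiased : forall x i,
    \int[PY]_y (grad (F ^~ y) x 0 i) = grad (objective PY F) x 0 i }.

Definition sample_mean (R : realType) (Ysp : Type) (d : nat)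
    (F : 'rV[R]_d -> Ysp -> R) (m : nat) (ys : nat -> Ysp) (x : 'rV[R]_d) : R :=
  m%:R^-1 * \sum_(j < m) F x (ys j).

Definition sample_grad (R : realType) (Ysp : Type) (d : nat)
    (F : 'rV[R]_d -> Ysp -> R) (m : nat) (ys : nat -> Ysp) (x : 'rV[R]_d) :
    'rV[R]_d :=
  m%:R^-1 *: \sum_(j < m) grad (F ^~ (ys j)) x.

Definition rel_error (R : realType) (dY : measure_display)
    (Ysp : measurableType dY) (PY : probability Ysp R) (d : nat)
    (F : 'rV[R]_d -> Ysp -> R) (c0 : R) (m : nat) (ys : nat -> Ysp)
    (x : 'rV[R]_d) : 'rV[R]_d :=
  let gf := grad (objective PY F) x in
  (enorm gf + c0)^-1 *: (sample_grad F m ys x - gf).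

Definition envelope (R : realType) (dY : measure_display)
    (Ysp : measurableType dY) (PY : probability Ysp R) (d : nat)
    (F : 'rV[R]_d -> Ysp -> R) (c0 alpha delta0 : R) (m : nat)
    (ys : nat -> Ysp) : \bar R :=
  ereal_sup (range (fun x : 'rV[R]_d =>
    (enorm (rel_error PY F c0 m ys x) *
      (enorm (grad (objective PY F) x) `^ alpha + delta0))%:E)).

(* [Yt j] is the (j+1)-st draw; outer iterations are numbered from 1, and the
   value [M 0] is never used. *)
Definition total_size (T : Type) (M : nat -> T -> nat) (k : nat) (w : T) : nat :=
  (\sum_(1 <= i < k.+1) M i w)%N.

Definition iter_sample (T Ysp : Type) (Yt : nat -> T -> Ysp)
    (M : nat -> T -> nat) (k : nat) (w : T) (j : nat) : Ysp :=
  Yt (total_size M k.-1 w + j)%N w.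

(* The sigma-algebra of the draws made up to iteration [k]. As their number is
   random, it is generated by the events "draw j has been made and lies in B";
   for [k = 0] it is trivial. *)
Definition history (T : Type) (dY : measure_display)
    (Ysp : measurableType dY) (Yt : nat -> T -> Ysp) (M : nat -> T -> nat)
    (k : nat) : set (set T) :=
  <<s [set A | exists j B, measurable B /\
         A = [set w | (j < total_size M k w)%N /\ B (Yt j w)]] >>.

(* [solver g x t] is the t-th iterate of the solver, started at [x], on the
   problem of minimizing [g]; [m1] is the constant initial sample size. *)
Record RA_run (R : realType) (T : Type) (dY : measure_display)
    (Ysp : measurableType dY) (d : nat) (F : 'rV[R]_d -> Ysp -> R)
    (Yt : nat -> T -> Ysp) (m1 : nat) (M : nat -> T -> nat)
    (eps : nat -> T -> R)
    (solver : ('rV[R]_d -> R) -> 'rV[R]_d -> nat -> 'rV[R]_d)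
    (X : nat -> T -> 'rV[R]_d) : Prop := {
  size_gt0 : forall k w, (1 <= k)%N -> (0 < M k w)%N ;
  size_init : forall w, M 1%N w = m1 ;
  size_measurable : forall k, (1 <= k)%N ->
    measurable_wrt (history Yt M k.-1) (M k) ;
  tol_ge0 : forall k w, (1 <= k)%N -> 0 <= eps k w ;
  tol_measurable : forall k, (1 <= k)%N ->
    measurable_wrt (history Yt M k.-1) (eps k) ;
  solver_start : forall g x, solver g x 0%N = x ;
  iterate_solver : forall k w, (1 <= k)%N -> exists t,
    X k w = solver (sample_mean F (M k w) (iter_sample Yt M k w))
                   (X k.-1 w) t ;
  iterate_tol : forall k w, (1 <= k)%N ->
    enorm (sample_grad F (M k w) (iter_sample Yt M k w) (X k w)) <= eps k w ;
  iterate_measurable : forall k i,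
    measurable_wrt (history Yt M k) (fun w => X k w 0 i) }.

(* Main.v *)
Require Import Defs.
From HB Require Import structures.
From mathcomp Require Import all_boot all_order all_algebra.
From mathcomp Require Import all_classical all_reals all_analysis.
From mathcomp Require Import measurable_realfun.
From mathcomp Require Import ring lra.

Set Implicit Arguments.
Unset Strict Implicit.
Unset Printing Implicit Defensive.

Import Order.TTheory GRing.Theory Num.Theory.
Import numFieldNormedType.Exports.

Local Open Scope classical_set_scope.
Local Open Scope ring_scope.

(** The gradient [g] of the objective at the new iterate is at most the
    tolerance plus the deviation of the sample gradient from it, and the
    envelope [H] controls this deviation by [(g + c0) * r] with
    [r * (g `^ alpha + delta0) <= H], whence
    [g <= eps + H * g `^ (1 - alpha) + c0 * H / delta0].  As the power of [g] on
    the right is below one, Young's inequality absorbs it in the left-hand side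
    ([absorb_powR]), at the price of [(theta * H) `^ alpha^-1] where
    [kappa2 = theta * sigma0]; this is [gradient_bound].

    The hypothesis bounds the conditional expectation of
    [V = (sqrt M * H) `^ alpha^-1], and [gradient_bound] also has a term linear
    in [H].  Instead of a conditional Jensen inequality, the concave function
    [V |-> V `^ alpha] is replaced by one of its tangents
    ([le_tangent_powR]).  Hence [g <= a M + b M * V] everywhere
    ([grad_le_envelope]), an inequality that is affine in [V] with coefficients
    that depend on the sample size only.

    Sample sizes are integers known to the past, so such a bound passes to
    conditional expectations level set by level set of the sample size, and no
    rule for taking known factors out is needed ([cond_exp_le_affine]).  It also
    makes [g] integrable, so that the Radon-Nikodym theorem on the past
    sigma-algebra supplies a conditional expectation ([cond_exp_exists]).
    Measurability of [g] holds because partial derivatives are limits of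
    difference quotients of a continuous function
    ([measurable_enorm_grad_comp]).  The tangent is taken at a point
    [s > sigma0] and [s] tends to [sigma0] ([cond_exp_le_limit]), which includes
    the case [sigma0 = 0], where the tangent would be vertical.

    For the rate, the sample sizes are at least [c1 ^+ (k - 1) * m1], so the
    bound of the first part is dominated by a constant, and this constant decays
    at the claimed speed since [1 / alpha >= 1] ([rate_of_growth]). *)

(** * The Euclidean norm *)

Lemma enorm_ge0 (R : realType) d (v : 'rV[R]_d) : 0 <= enorm v.
Proof. exact: sqrtr_ge0. Qed.

Lemma enormZ (R : realType) d (a : R) (v : 'rV[R]_d) :
  0 <= a -> enorm (a *: v) = a * enorm v.
Proof.
move=> a0; rewrite /enorm -[X in X * _](ger0_norm a0) -sqrtr_sqr -sqrtrM ?sqr_ge0//.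
by rewrite mulr_sumr; congr Num.sqrt; apply: eq_bigr => i _; rewrite mxE exprMn.
Qed.

Lemma enormC (R : realType) d (u v : 'rV[R]_d) : enorm (u - v) = enorm (v - u).
Proof.
by rewrite /enorm; congr Num.sqrt; apply: eq_bigr => i _; rewrite !mxE -sqrrN opprB.
Qed.

(** Cauchy-Schwarz, from Lagrange's identity: twice the gap between the two
    sides is the sum of the squares [(u i * v j - u j * v i) ^+ 2]. *)
Lemma sqr_sum_mul_le (R : realDomainType) (I : finType) (u v : I -> R) :
  (\sum_i u i * v i) ^+ 2 <= (\sum_i u i ^+ 2) * (\sum_i v i ^+ 2).
Proof.
have : 0 <= \sum_i \sum_j (u i * v j - u j * v i) ^+ 2.
  by apply: sumr_ge0 => i _; apply: sumr_ge0 => j _; rewrite sqr_ge0.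
set U := \sum_i _ ^+ 2; set V := \sum_i v i ^+ 2; set W := \sum_i u i * v i.
have -> : \sum_i \sum_j (u i * v j - u j * v i) ^+ 2 = U * V + V * U - 2 * W ^+ 2.
  have -> : 2 * W ^+ 2 = \sum_i \sum_j 2 * ((u i * v i) * (u j * v j)).
    rewrite expr2 [X in 2 * X]big_distrlr mulr_sumr.
    by apply: eq_bigr => i _; rewrite mulr_sumr.
  rewrite [U * V]big_distrlr [V * U]big_distrlr/= -big_split -sumrB/=.
  apply: eq_bigr => i _; rewrite -big_split -sumrB/=; apply: eq_bigr => j _; ring.
by rewrite [V * U]mulrC => h; lra.
Qed.

Lemma enormD (R : realType) d (u v : 'rV[R]_d) : enorm (u + v) <= enorm u + enorm v.
Proof.
have sq (w : 'rV[R]_d) : enorm w ^+ 2 = \sum_i w 0 i ^+ 2.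
  by rewrite sqr_sqrtr// sumr_ge0// => i _; exact: sqr_ge0.
rewrite -(@ler_pXn2r _ 2)// ?nnegrE ?addr_ge0 ?enorm_ge0// sqrrD !sq.
set W := \sum_(i < d) u 0 i * v 0 i.
have -> : \sum_(i < d) (u + v) 0 i ^+ 2 =
    \sum_(i < d) u 0 i ^+ 2 + W *+ 2 + \sum_(i < d) v 0 i ^+ 2.
  by rewrite -sumrMnl -!big_split/=; apply: eq_bigr => i _; rewrite mxE sqrrD.
rewrite lerD2r; apply: lerD; first exact: lexx.
rewrite lerMn2r/=; apply: le_trans (ler_norm _) _.
rewrite -(@ler_pXn2r _ 2)// ?nnegrE ?mulr_ge0 ?enorm_ge0// real_normK ?num_real//.
by rewrite exprMn !sq; exact: sqr_sum_mul_le.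
Qed.

(** * Consequences of Young's inequality *)

(** The right-hand side is the tangent, at [s `^ alpha^-1], of the concave
    function [V |-> V `^ alpha], evaluated at [V = h `^ alpha^-1].  That it lies
    above is Young's inequality with exponents [alpha^-1] and
    [(1 - alpha)^-1]. *)
Lemma le_tangent_powR (R : realType) (alpha s h : R) :
  0 < alpha -> alpha < 1 -> 0 < s -> 0 <= h ->
  h <= (1 - alpha) * s + alpha * s `^ (1 - alpha^-1) * h `^ alpha^-1.
Proof.
move=> a0 a1 s0 h0.
have sne : s != 0 by rewrite gt_eqF.
have b0 : 0 < 1 - alpha by rewrite subr_gt0.
have := @conjugate_powR _ (h / s `^ (1 - alpha)) (s `^ (1 - alpha))
  alpha^-1 (1 - alpha)^-1.
rewrite !invrK divr_ge0 ?powR_ge0// !invr_gt0 => /(_ isT isT a0 b0).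
rewrite subrKC => /(_ erefl).
rewrite divfK ?powR_eq0 ?negb_and ?sne// => /le_trans; apply.
rewrite -[(s `^ (1 - alpha)) `^ (1 - alpha)^-1]powRrM mulfV ?gt_eqF// powRr1 ?(ltW s0)//.
rewrite powRM ?invr_ge0 ?powR_ge0//.
have -> : (s `^ (1 - alpha))^-1 `^ alpha^-1 = s `^ (1 - alpha^-1).
  rewrite -powRN -powRrM; congr (_ `^ _).
  by rewrite mulNr mulrBl mul1r mulfV ?gt_eqF// opprB.
by rewrite le_eqVlt; apply/orP; left; apply/eqP; ring.
Qed.

(** Young's inequality for the product of [c * H] and [g `^ (1 - alpha) / c], the
    weight [c] being chosen so that [g] comes out with the factor [1 / 2].  The
    coefficient of [H `^ alpha^-1] that results is half of the one stated; the
    latter is the one that gives [kappa2]. *)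
Lemma absorb_powR (R : realType) (alpha H g : R) :
  0 < alpha -> alpha < 1 -> 0 <= H -> 0 <= g ->
  2 * (H * g `^ (1 - alpha)) <=
  g + (2 * (1 - alpha) * (2 * alpha / (1 - alpha)) `^ alpha * H) `^ alpha^-1.
Proof.
move=> a0 a1 H0 g0.
have b0 : 0 < 1 - alpha by rewrite subr_gt0.
set b := 1 - alpha in b0 *.
have ane : alpha != 0 by rewrite gt_eqF.
have bne : b != 0 by rewrite gt_eqF.
pose c := (2 * b) `^ b.
have c0 : 0 < c by rewrite powR_gt0// mulr_gt0.
have := @conjugate_powR _ (c * H) (g `^ b / c) alpha^-1 b^-1.
rewrite !invrK divr_ge0 ?powR_ge0 ?mulr_ge0 ?(ltW c0)//.
rewrite !invr_gt0 => /(_ isT isT a0 b0); rewrite subrKC => /(_ erefl).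
have -> : c * H * (g `^ b / c) = H * g `^ b.
  by rewrite mulrC -!mulrA [_ * (c * H)]mulrA mulVf ?gt_eqF// mul1r mulrC.
have -> : (g `^ b / c) `^ b^-1 = g / (2 * b).
  rewrite powRM ?powR_ge0 ?invr_ge0 ?(ltW c0)// -powRrM mulfV// powRr1//.
  rewrite -powR_inv1 ?(ltW c0)// -!powRrM mulN1r mulrN mulfV//.
  by rewrite powR_inv1// mulr_ge0// ltW.
have -> : g / (2 * b) * b = g / 2 by field; rewrite bne.
rewrite powRM ?(ltW c0)// -powRrM => yle.
have tb0 : 0 <= 2 * b by rewrite mulr_ge0// ltW.
have -> : (2 * b * (2 * alpha / b) `^ alpha * H) `^ alpha^-1 =
    (2 * b) `^ alpha^-1 * (2 * alpha / b) * H `^ alpha^-1.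
  rewrite (@powRM _ (2 * b * _) H) ?mulr_ge0 ?powR_ge0 ?(ltW b0)//.
  rewrite (@powRM _ (2 * b) (_ `^ alpha)) ?powR_ge0//.
  by rewrite -(powRrM _ alpha) mulfV// powRr1// divr_ge0 ?mulr_ge0 ?ltW.
have e : (2 * b) `^ alpha^-1 = (2 * b) `^ (b / alpha) * (2 * b).
  rewrite -[X in _ = _ * X]powRr1// -powRD; last first.
    by rewrite mulf_neq0 ?pnatr_eq0// implybT.
  by congr (_ `^ _); rewrite /b; field.
rewrite e; set K := (2 * b) `^ (b / alpha) in yle *.
have -> : K * (2 * b) * (2 * alpha / b) = 4 * alpha * K by field.
have K0 : 0 <= K * H `^ alpha^-1 * alpha.
  by rewrite !mulr_ge0 ?powR_ge0 ?(ltW a0).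
have -> : 4 * alpha * K * H `^ alpha^-1 = 4 * (K * H `^ alpha^-1 * alpha) by ring.
lra.
Qed.

(** Here [e] is the norm of the sample gradient, [g] that of the true gradient,
    [r] the relative error and [H] the envelope.  The implicit inequality in [g]
    is solved by splitting [r * g = r * g `^ alpha * g `^ (1 - alpha)]. *)
Lemma gradient_bound (R : realType) (alpha c0 delta0 g e r H : R) :
  0 < alpha -> alpha < 1 -> 0 < c0 -> 0 < delta0 ->
  0 <= g -> 0 <= r -> g <= e + (g + c0) * r -> r * (g `^ alpha + delta0) <= H ->
  g <= 2 * e + 2 * c0 / delta0 * H +
    (2 * (1 - alpha) * (2 * alpha / (1 - alpha)) `^ alpha * H) `^ alpha^-1.
Proof.
move=> a0 a1 c00 d0 g0 r0 gle Hle.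
have H0 : 0 <= H by rewrite (le_trans _ Hle)// mulr_ge0// addr_ge0 ?powR_ge0// ltW.
have rg : r * g <= H * g `^ (1 - alpha).
  have -> : r * g = r * g `^ alpha * g `^ (1 - alpha).
    by rewrite -mulrA -powRD subrKC ?oner_eq0// powRr1.
  rewrite ler_wpM2r ?powR_ge0// (le_trans _ Hle)// ler_wpM2l// lerDl ltW//.
have rc : c0 * r <= c0 / delta0 * H.
  rewrite -mulrA ler_wpM2l ?(ltW c00)// ler_pdivlMl// (le_trans _ Hle)//.
  by rewrite mulrC ler_wpM2l// lerDr powR_ge0.
have := @absorb_powR _ alpha H g a0 a1 H0 g0.
have -> : 2 * c0 / delta0 * H = 2 * (c0 / delta0 * H) by ring.
rewrite mulrDl [g * r]mulrC in gle.
lra.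
Qed.

(** * Conditional expectations *)

(** Makes a set function on [T] usable as a measure on a coarser
    sigma-algebra, as the Radon-Nikodym theorem requires. *)
Lemma finite_measure_restrict (R : realType) (d : measure_display)
    (T : measurableType d) (m : set T -> \bar R) (GG : set (set T)) :
  <<s GG >> `<=` measurable -> m set0 = 0%E -> (forall A, (0 <= m A)%E) ->
  semi_sigma_additive m -> (m setT < +oo)%E ->
  exists nu : {finite_measure set (g_sigma_algebraType GG) -> \bar R},
    forall A, nu A = m A.
Proof.
move=> sG m0 m_ge0 msa mT; pose TG := g_sigma_algebraType GG.
have sa : semi_sigma_additive (m : set TG -> \bar R).
  by move=> F mF tF mUF; apply: (msa _ _ tF) => [i|]; apply: sG; [exact: mF|exact: mUF].
pose M1 := isMeasure.Build _ TG R m m0 m_ge0 sa.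
pose mu : {measure set TG -> \bar R} := HB.pack m M1.
have fin : fin_num_fun (m : set TG -> \bar R).
  move=> A mA; rewrite ge0_fin_numE; last exact: m_ge0.
  apply: le_lt_trans mT.
  exact: (@le_measure _ _ _ mu A setT (mem_set mA) (mem_set measurableT) (@subsetT _ A)).
pose M2 := @Measure_isFinite.Build _ TG R mu fin.
pose nu : {finite_measure set TG -> \bar R} := HB.pack (Measure.sort mu) M2.
by exists nu.
Qed.

(** The identity from [T] to the coarser space pushes [P] forward to its
    restriction, so this is a change of variables. *)
Lemma integral_restrict (R : realType) (d : measure_display)
    (T : measurableType d) (P : {measure set T -> \bar R}) (GG : set (set T))
    (mu : {measure set (g_sigma_algebraType GG) -> \bar R}) (A : set T)
    (C : T -> \bar R) :
  <<s GG >> `<=` measurable -> (forall A, mu A = P A) -> <<s GG >> A ->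
  measurable_wrt <<s GG >> C -> (forall w, (0 <= C w)%E) ->
  (\int[mu]_(w in A) C w = \int[P]_(w in A) C w)%E.
Proof.
move=> sG muE GA mC C0; pose TG := g_sigma_algebraType GG.
have mid : measurable_fun setT (idfun : T -> TG).
  by move=> _ B mB; rewrite setTI; exact: sG.
have mCG : @measurable_fun _ _ TG _ A C.
  by apply: measurable_funTS => _ B mB; rewrite setTI; exact: mC.
rewrite -(@ge0_integral_pushforward _ _ T TG _ idfun mid P A C)//.
by apply: eq_measure_integral => B _ _ /=; rewrite muE.
Qed.

(** The conditional expectation is the Radon-Nikodym derivative, on the
    coarser sigma-algebra, of the measure with density [Z].  This measure has
    to be finite, hence the integrability assumption. *)
Lemma cond_exp_exists (R : realType) (d : measure_display)
    (T : measurableType d) (P : probability T R) (GG : set (set T))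
    (Z : T -> \bar R) :
  <<s GG >> `<=` measurable -> measurable_fun setT Z ->
  (forall w, (0 <= Z w)%E) -> (\int[P]_w Z w < +oo)%E ->
  exists C, is_cond_exp P <<s GG >> Z C.
Proof.
move=> sG mZ Z0 Zoo.
have [mu muE] : exists mu : {finite_measure set (g_sigma_algebraType GG) -> \bar R},
    forall A, mu A = P A.
  apply: finite_measure_restrict => //; first exact: measure_semi_sigma_additive.
  by rewrite probability_setT ltry.
have [nu nuE] : exists nu : {finite_measure set (g_sigma_algebraType GG) -> \bar R},
    forall A, nu A = (\int[P]_(w in A) Z w)%E.
  apply: finite_measure_restrict => //; first by rewrite integral_set0.
    by move=> A; exact: integral_ge0.
  exact: semi_sigma_additive_nng_induced.
have /radon_nikodym_finite[C [C0 /measurable_int mC CE]] : nu `<< mu.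
  apply/null_content_dominatesP => A mA; rewrite nuE => muA0.
  have PA0 : P A = 0%E by rewrite -muE.
  under eq_integral do rewrite -[Z _]gee0_abs//.
  by rewrite integral_abs_eq0//; [exact: sG|exact: measurable_funTS].
exists C; have wC : measurable_wrt <<s GG >> C.
  by move=> B mB; rewrite -[X in <<s _ >> X]setTI; exact: mC.
split => // A GA; rewrite -(integral_restrict sG muE)// -CE// nuE.
Qed.

(** On the set where [C] exceeds [c] by [1 / (n + 1)], the integral of [C] would
    be too large unless the set is null; the set where [C > c] is the union of
    these over [n]. *)
Lemma negligible_gt_of_integral_le (R : realType) (d : measure_display)
    (T : measurableType d) (P : probability T R) (GG : set (set T))
    (N : set T) (C : T -> \bar R) (c : R) :
  <<s GG >> `<=` measurable -> <<s GG >> N -> measurable_wrt <<s GG >> C ->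
  (forall w, (0 <= C w)%E) -> 0 <= c ->
  (forall A, <<s GG >> A -> A `<=` N -> (\int[P]_(w in A) C w <= c%:E * P A)%E) ->
  P.-negligible (N `&` [set w | (c%:E < C w)%E]).
Proof.
move=> sG GN mC C0 c0 CP.
have mCT : measurable_fun setT C by move=> _ B mB; rewrite setTI; apply: sG; exact: mC.
pose e n := c + n.+1%:R^-1.
pose E n := N `&` C @^-1` `[(e n)%:E, +oo[%classic.
have GE n : <<s GG >> (E n).
  apply: (@measurableI _ (g_sigma_algebraType GG)); first exact: GN.
  by apply: mC; exact: emeasurable_itv.
apply: (@negligibleS _ _ _ P (\bigcup_n E n)); last first.
  apply: negligible_bigcup => n; apply/negligibleP; first exact: sG.
  have e0 : 0 <= e n by rewrite addr_ge0.
  have : ((e n)%:E * P (E n) <= c%:E * P (E n))%E.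
    apply: le_trans (CP _ (GE n) (@subIsetl _ _ _)).
    rewrite -integral_cst; last exact: sG.
    apply: ge0_le_integral => //; [exact: sG| exact: measurable_funTS|].
    by move=> w [_ /=]; rewrite in_itv/= andbT.
  rewrite -(fineK (fin_num_measure P _ (sG _ (GE n)))) -!EFinM !lee_fin.
  rewrite /e mulrDl gerDl pmulr_rle0 ?invr_gt0// => r_le0.
  have r0 : fine (P (E n)) = 0 by apply/eqP; rewrite eq_le r_le0 fine_ge0.
  by rewrite -[LHS]fineK ?fin_num_measure ?r0//; exact: sG.
move=> w [Nw /= cC].
suff [n en] : exists n, ((e n)%:E <= C w)%E by exists n => //; split => //=; rewrite in_itv/= en.
move: cC; case: (C w) => [r| |] //; last by exists 0%N; rewrite leey.
rewrite lte_fin => cr; exists (Num.truncn (r - c)^-1).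
rewrite lee_fin /e -lerBrDl invf_ple ?posrE ?subr_gt0//.
by rewrite ltW// truncnS_gt.
Qed.

(** The function [N] is known to the conditioning sigma-algebra and takes
    countably many values, so it suffices to compare integrals over events
    on which [N], hence the pair of coefficients, is constant.  The bound [K]
    serves to make [Z] integrable. *)
Lemma cond_exp_le_affine (R : realType) (d : measure_display)
    (T : measurableType d) (P : probability T R) (GG : set (set T))
    (N : T -> nat) (Z : T -> R) (V : T -> \bar R) (a b : nat -> R) (K v : R) :
  <<s GG >> `<=` measurable -> measurable_wrt <<s GG >> N ->
  measurable_fun setT Z -> (forall w, 0 <= Z w) -> (forall w, (0 <= V w)%E) ->
  (forall n, 0 <= a n <= K) -> (forall n, 0 <= b n <= K) -> 0 <= v ->
  (forall w, ((Z w)%:E <= (a (N w))%:E + (b (N w))%:E * V w)%E) ->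
  cond_exp_le P <<s GG >> V (fun=> v%:E) ->
  cond_exp_le P <<s GG >> (EFin \o Z) (fun w => (a (N w) + b (N w) * v)%:E).
Proof.
move=> sG mN mZ Z0 V0 aK bK v0 ZV [[D hD] /(_ D hD) Dv].
case: hD => [mV mD D0 DV].
have DT : measurable_fun setT D by move=> _ B mB; rewrite setTI; apply: sG; exact: mD.
have intZ A x y : <<s GG >> A -> 0 <= x -> 0 <= y ->
    (forall w, A w -> ((Z w)%:E <= x%:E + y%:E * V w)%E) ->
    (\int[P]_(w in A) (Z w)%:E <= (x + y * v)%:E * P A)%E.
  move=> GA x0 y0 ZA; have mA : measurable A by exact: sG.
  have mVA : measurable_fun A V by exact: measurable_funTS.
  apply: (@le_trans _ _ (\int[P]_(w in A) (x%:E + y%:E * V w))%E).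
    apply: ge0_le_integral => //.
    - by move=> w _; rewrite lee_fin.
    - exact/measurable_EFinP/measurable_funTS.
    - by apply: emeasurable_funD => //; exact: measurable_funeM.
  rewrite ge0_integralD//; last 2 first.
  - by move=> w _; rewrite mule_ge0.
  - exact: measurable_funeM.
  rewrite ge0_integralZl//.
  rewrite integral_cst// -DV// EFinD muleDl ?fin_num_measure// leeD2l//.
  rewrite EFinM -muleA lee_wpmul2l// -integral_cst//.
  apply: ae_ge0_le_integral => //; first exact: measurable_funTS.
  by apply: filterS Dv => w Dw _.
have K0 : 0 <= K by case/andP: (aK 0%N) => /le_trans; apply.
split.
  apply: cond_exp_exists => //; first exact/measurable_EFinP.
  apply: (@le_lt_trans _ _ ((K + K * v)%:E * P setT)%E); last first.
    by rewrite probability_setT mule1 ltry.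
  apply: intZ => // [|w _].
    exact: (@measurableT _ (g_sigma_algebraType GG)).
  apply: le_trans (ZV w) _; apply: leeD; first by rewrite lee_fin; case/andP: (aK (N w)).
  by rewrite lee_wpmul2r// lee_fin; case/andP: (bK (N w)).
move=> C [_ mC C0 CZ].
pose A n := N @^-1` [set n].
apply: (@negligibleS _ _ _ P
    (\bigcup_n (A n `&` [set w | ((a n + b n * v)%:E < C w)%E]))); last first.
  apply: negligible_bigcup => n.
  have [an0 bn0] : 0 <= a n /\ 0 <= b n by case/andP: (aK n) (bK n) => -> _ /andP[].
  apply: (negligible_gt_of_integral_le sG) => //.
  - exact: mN.
  - by rewrite addr_ge0// mulr_ge0.
  - move=> B GB BA; rewrite CZ//; apply: intZ => // w /BA/= <-; exact: ZV.
by move=> w /= /negP; rewrite -ltNge => ?; exists (N w).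
Qed.

(** The exceptional null sets for [e = 1 / (n + 1)] are countably many. *)
Lemma cond_exp_le_limit (R : realType) (d : measure_display)
    (T : measurableType d) (P : probability T R) (G : set (set T))
    (Z : T -> \bar R) (B : T -> R) :
  (forall e, 0 < e -> cond_exp_le P G Z (fun w => (B w + e)%:E)) ->
  cond_exp_le P G Z (fun w => (B w)%:E).
Proof.
move=> ZB; split; first by case: (ZB 1 ltr01).
move=> C ZC; have : {ae P, forall w, forall n : nat, (C w <= (B w + n.+1%:R^-1)%:E)%E}.
  by apply/ae_foralln => n; apply: (ZB _ _).2.
apply: filterS => w Cw; apply/lee_addgt0Pr => e e0.
have [n en] : exists n : nat, n.+1%:R^-1 < e.
  exists (Num.truncn e^-1); rewrite invf_plt ?posrE//; exact: truncnS_gt.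
by rewrite (le_trans (Cw n))// -EFinD lee_fin lerD2l ltW.
Qed.

Lemma cond_exp_le_weaken (R : realType) (d : measure_display)
    (T : measurableType d) (P : probability T R) (G : set (set T))
    (Z B B' : T -> \bar R) :
  cond_exp_le P G Z B -> (forall w, (B w <= B' w)%E) -> cond_exp_le P G Z B'.
Proof.
move=> [CZ ZB] BB'; split=> // C /ZB; apply: filterS => w CB.
exact: le_trans CB (BB' w).
Qed.

(** The tower property: a conditional expectation of [Z] has the same integral
    as [Z]. *)
Lemma expectation_le_cond_exp (R : realType) (d : measure_display)
    (T : measurableType d) (P : probability T R) (GG : set (set T))
    (Z : T -> R) (B : T -> \bar R) (c : R) :
  <<s GG >> `<=` measurable -> 0 <= c ->
  cond_exp_le P <<s GG >> (EFin \o Z) B -> (forall w, (B w <= c%:E)%E) ->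
  ('E_P[Z] <= c%:E)%E.
Proof.
move=> sG c0 [[C CZ] ZB] Bc; rewrite unlock; have := ZB C CZ.
case: CZ => mZ mC C0 CE CB.
have <- := CE setT (@measurableT _ (g_sigma_algebraType GG)).
have mCT : measurable_fun setT C by move=> _ S mS; rewrite setTI; apply: sG; exact: mC.
rewrite -[leRHS]mule1 -(@probability_setT _ _ _ P) -integral_cst//.
apply: ae_ge0_le_integral => //.
by apply: filterS CB => w Cw _; exact: le_trans (Bc w).
Qed.

(** * Measurability of gradients and of the history *)

Lemma measurable_floor_eq (R : realType) (z : int) (r : R) (d : measure_display)
    (T : measurableType d) (x : T -> R) :
  measurable_fun setT x -> measurable [set w | Num.floor (x w * r) = z].
Proof.
move=> mx; have mxr : measurable_fun setT (fun w => x w * r) by exact: measurable_funM.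
have -> : [set w | Num.floor (x w * r) = z] =
    setT `&` (fun w => x w * r) @^-1` `[z%:~R, (z + 1)%:~R[%classic.
  rewrite setTI; apply/seteqP; split => w /=; rewrite in_itv/= -floor_eq.
    by move=> ->.
  by move/eqP.
by apply: mxr => //; exact: measurable_itv.
Qed.

(** The coordinates of [X] are rounded down to multiples of [1 / (m + 1)].  The
    rounded point takes countably many values, so any function of it is
    measurable, and continuity recovers [phi \o X] in the limit.  This avoids
    comparing the Borel sets of ['rV[R]_n] with the product sigma-algebra. *)
Lemma measurable_continuous_comp_rV (R : realType) (d : measure_display)
    (T : measurableType d) (n : nat) (phi : 'rV[R]_n -> R) (X : T -> 'rV[R]_n) :
  continuous phi -> (forall i, measurable_fun setT (fun w => X w 0 i)) ->
  measurable_fun setT (phi \o X).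
Proof.
move=> cphi mX.
pose idx (m : nat) w : 'rV[int]_n := \row_i Num.floor (X w 0 i * m.+1%:R).
pose grid (m : nat) (v : 'rV[int]_n) : 'rV[R]_n := \row_i ((v 0 i)%:~R / m.+1%:R).
have dist m w i : `|X w 0 i - grid m (idx m w) 0 i| <= m.+1%:R^-1.
  rewrite !mxE -[X in X - _](@mulfK _ m.+1%:R)// -mulrBl normrM.
  rewrite [X in _ * X]ger0_norm// ler_piMl//.
  rewrite ger0_norm ?subr_ge0 ?floor_le// lerBlDl ltW//.
  by rewrite -[1]/(1%:~R) -intrD floorD1_gt.
apply: (@measurable_fun_cvg _ _ _ _ (fun m => phi \o (fun w => grid m (idx m w)))).
  move=> m _ B mB; rewrite setTI.
  have -> : (phi \o (fun w => grid m (idx m w))) @^-1` B =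
      \bigcup_(v : 'rV[int]_n) ([set w | idx m w = v] `&` [set w | B (phi (grid m v))]).
    apply/seteqP; split => w /=; first by exists (idx m w).
    by move=> [v _ [/= ->]].
  apply: countable_bigcupT_measurable => [|v].
    exact: countableP.
  apply: measurableI; last first.
    have [Bv|nBv] := pselect (B (phi (grid m v))).
      by rewrite (_ : [set _ | _] = setT)//; apply/seteqP; split.
    by rewrite (_ : [set _ | _] = set0)//; apply/seteqP; split.
  rewrite (_ : [set _ | _] =
    \bigcap_(i : 'I_n) [set w | Num.floor (X w 0 i * m.+1%:R) = v 0 i]).
    apply: fin_bigcap_measurable => [|i _]; first exact: finite_finset.
    exact: measurable_floor_eq.
  apply/seteqP; split => w /=.
    by move=> <- i _ /=; rewrite mxE.
  by move=> h; apply/rowP => i; rewrite mxE h.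
move=> w _; apply: continuous_cvg; first exact: cphi.
apply/cvg_ballP => e e0; near=> m; split => // i j.
rewrite ord1; apply: le_lt_trans (dist m w j) _.
near: m; exact: near_infty_natSinv_lt (PosNum e0).
Unshelve. all: by end_near. Qed.

(** The gradient need not be continuous; each of its entries is the pointwise
    limit of the difference quotients with increment [1 / (m + 1)], which are
    continuous in the base point. *)
Lemma measurable_grad_comp (R : realType) (d : measure_display)
    (T : measurableType d) (n : nat) (f : 'rV[R]_n -> R) (X : T -> 'rV[R]_n) (i : 'I_n) :
  (forall x, differentiable f x) ->
  (forall i, measurable_fun setT (fun w => X w 0 i)) ->
  measurable_fun setT (fun w => grad f (X w) 0 i).
Proof.
move=> df mX; pose v : 'rV[R]_n := delta_mx 0 i.
have cf : continuous f by move=> x; exact: differentiable_continuous.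
pose q (m : nat) (x : 'rV[R]_n) := (m.+1%:R^-1)^-1 * (f (m.+1%:R^-1 *: v + x) - f x).
apply: (@measurable_fun_cvg _ _ _ _ (fun m => q m \o X)).
  move=> m; apply: measurable_continuous_comp_rV => // x.
  have sx : m.+1%:R^-1 *: v + y @[y --> x] --> m.+1%:R^-1 *: v + x.
    exact: (cvgD (cvg_cst _) cvg_id).
  have fsx : f (m.+1%:R^-1 *: v + y) @[y --> x] --> f (m.+1%:R^-1 *: v + x).
    exact: (@cvg_comp _ _ _ _ f _ _ _ sx (cf _)).
  exact: (cvgM (cvg_cst _) (cvgB fsx (cf x))).
move=> w _; rewrite mxE.
have /cvgr_dnbhsP h : h^-1 *: ((f \o shift (X w)) (h *: v) - f (X w))
    @[h --> 0^'] --> 'D_v f (X w).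
  exact: diff_derivable.
apply: (h (fun m => m.+1%:R^-1)); split; first by move=> m; rewrite invr_neq0.
exact: cvg_harmonic.
Qed.

Lemma measurable_enorm_grad_comp (R : realType) (d : measure_display)
    (T : measurableType d) (n : nat) (f : 'rV[R]_n -> R) (X : T -> 'rV[R]_n) :
  (forall x, differentiable f x) ->
  (forall i, measurable_fun setT (fun w => X w 0 i)) ->
  measurable_fun setT (fun w => enorm (grad f (X w))).
Proof.
move=> df mX; apply: (measurableT_comp (continuous_measurable_fun (@sqrt_continuous R))).
apply: measurable_sum => i; apply: measurable_funX; exact: measurable_grad_comp.
Qed.

(** The events generating the history at [k] involve the random total sample
    size, which is measurable because its last summand is measurable with
    respect to the history at [k - 1]; hence an induction. *)
Lemma sub_history_measurable (R : realType) (dT dY : measure_display)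
    (T : measurableType dT) (Ysp : measurableType dY) (P : probability T R)
    (Yt : nat -> {RV P >-> Ysp}) (M : nat -> T -> nat) :
  (forall k, (1 <= k)%N -> measurable_wrt (history Yt M k.-1) (M k)) ->
  forall k, history Yt M k `<=` measurable.
Proof.
move=> mM k.
suff [] : measurable_fun setT (total_size M k) /\ history Yt M k `<=` measurable by [].
have hist j : measurable_fun setT (total_size M j) -> history Yt M j `<=` measurable.
  move=> mt; apply: smallest_sub; first exact: sigma_algebra_measurable.
  move=> _ [i [B [mB ->]]]; apply: measurableI.
    by rewrite -[X in measurable X]setTI; apply: (mt _ [set m | (i < m)%N]).
  by rewrite -[X in measurable X]setTI; exact: measurable_funPT.
elim: k => [|k [mt hk]]; last first.
  suff mtS : measurable_fun setT (total_size M k.+1) by split => //; exact: hist.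
  have mS : measurable_fun setT (M k.+1).
    by move=> _ B mB; rewrite setTI; apply: hk; exact: (mM k.+1).
  rewrite (_ : total_size M k.+1 = fun w => (total_size M k w + M k.+1 w)%N).
    exact: measurable_fun_addn.
  by apply/funext => w; rewrite /total_size big_nat_recr.
suff mt0 : measurable_fun setT (total_size M 0) by split => //; exact: hist.
rewrite (_ : total_size M 0 = cst 0%N)//; apply/funext => w.
by rewrite /total_size big_geq.
Qed.

(** * The gradient bound given the past *)

Lemma envelope_ge (R : realType) (dY : measure_display)
    (Ysp : measurableType dY) (PY : probability Ysp R) (d : nat)
    (F : 'rV[R]_d -> Ysp -> R) (c0 alpha delta0 : R) (m : nat)
    (ys : nat -> Ysp) (x : 'rV[R]_d) :
  ((enorm (rel_error PY F c0 m ys x) *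
      (enorm (grad (objective PY F) x) `^ alpha + delta0))%:E
   <= envelope PY F c0 alpha delta0 m ys)%E.
Proof. by apply: ereal_sup_ubound; exists x. Qed.

(** [gradient_bound] with its linear term in the envelope replaced by the
    tangent bound.  If the envelope is infinite the right-hand side is infinite
    too, because the coefficient of the power is positive. *)
Lemma grad_le_envelope (R : realType) (dY : measure_display)
    (Ysp : measurableType dY) (PY : probability Ysp R) (d : nat)
    (F : 'rV[R]_d -> Ysp -> R) (c0 alpha delta0 e s : R) (m : nat)
    (ys : nat -> Ysp) (x : 'rV[R]_d) :
  let theta := 2 * (1 - alpha) * (2 * alpha / (1 - alpha)) `^ alpha in
  0 < c0 -> 0 < alpha -> alpha < 1 -> 0 < delta0 -> 0 < s -> (0 < m)%N ->
  enorm (sample_grad F m ys x) <= e ->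
  ((enorm (grad (objective PY F) x))%:E <=
   (2 * e + 2 * c0 / delta0 / Num.sqrt m%:R * ((1 - alpha) * s))%:E +
   (2 * c0 / delta0 / Num.sqrt m%:R * (alpha * s `^ (1 - alpha^-1)) +
      (theta / Num.sqrt m%:R) `^ alpha^-1)%:E *
   ((Num.sqrt m%:R)%:E * envelope PY F c0 alpha delta0 m ys) `^ alpha^-1)%E.
Proof.
move=> theta c00 a0 a1 d0 s0 m0 xe.
set g := enorm (grad _ x); set rm := Num.sqrt m%:R.
have rm0 : 0 < rm by rewrite sqrtr_gt0 ltr0n.
have g0 : 0 <= g by exact: enorm_ge0.
have theta0 : 0 < theta by rewrite mulr_gt0 ?powR_gt0 ?divr_gt0 ?mulr_gt0 ?subr_gt0.
set r := enorm (rel_error PY F c0 m ys x).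
have r0 : 0 <= r by exact: enorm_ge0.
have gle : g <= e + (g + c0) * r.
  have gc : 0 < g + c0 by rewrite ltr_wpDl.
  rewrite /r /rel_error enormZ ?invr_ge0 ?(ltW gc)// mulVKf ?gt_eqF//.
  have {1}-> : g = enorm (sample_grad F m ys x
      + (grad (objective PY F) x - sample_grad F m ys x)) by rewrite subrKC.
  by rewrite (le_trans (enormD _ _))// enormC lerD2r.
have := envelope_ge PY F c0 alpha delta0 m ys x.
case: (envelope _ _ _ _ _ _ _) => [H||//].
  rewrite lee_fin -/g -/r => Hle.
  rewrite -(EFinM rm H) poweR_EFin -EFinM -EFinD lee_fin.
  have H0 : 0 <= H by rewrite (le_trans _ Hle)// mulr_ge0// addr_ge0 ?powR_ge0// ltW.
  apply: le_trans (gradient_bound a0 a1 c00 d0 g0 r0 gle Hle) _.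
  have -> : (2 * (1 - alpha) * (2 * alpha / (1 - alpha)) `^ alpha * H) `^ alpha^-1 =
      (theta / rm) `^ alpha^-1 * (rm * H) `^ alpha^-1.
    rewrite -powRM; [|by rewrite ltW// divr_gt0|by rewrite mulr_ge0// ltW].
    by congr (_ `^ _); rewrite -/theta; field; rewrite gt_eqF.
  have -> : 2 * c0 / delta0 * H = 2 * c0 / delta0 / rm * (rm * H).
    by field; rewrite !gt_eqF.
  set K := 2 * c0 / delta0 / rm.
  have K0 : 0 <= K by rewrite ?divr_ge0 ?mulr_ge0 ?(ltW c00) ?(ltW d0) ?(ltW rm0).
  have rH0 : 0 <= rm * H by rewrite mulr_ge0// ltW.
  have := ler_wpM2l K0 (le_tangent_powR a0 a1 s0 rH0).
  lra.
move=> _; rewrite gt0_muley ?lte_fin// poweRyr ?invr_eq0 ?gt_eqF// gt0_muley.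
  by rewrite addey// leey.
rewrite lte_fin ltr_wpDl ?powR_gt0 ?divr_gt0//.
by rewrite !mulr_ge0 ?powR_ge0 ?invr_ge0 ?(ltW c00) ?(ltW d0) ?(ltW rm0) ?(ltW a0).
Qed.

(** The value [n = 0] is covered because the inverse of [0] is [0]; the
    coefficients in [grad_cond_exp_le] are thus bounded on all of [nat]. *)
Lemma inv_sqrt_nat_itv (R : realType) (n : nat) :
  0 <= (Num.sqrt n%:R : R)^-1 <= 1.
Proof.
rewrite invr_ge0 sqrtr_ge0/=; case: n => [|n]; first by rewrite sqrtr0 invr0.
by rewrite invf_le1 ?sqrtr_gt0// -[leLHS]sqrtr1 ler_sqrt ?ler0n ?ler1n.
Qed.

Lemma inv_powR_nat_itv (R : realType) (p : R) (n : nat) :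
  0 < p -> 0 <= (n%:R `^ p)^-1 <= 1.
Proof.
move=> p0; rewrite invr_ge0 powR_ge0/=; case: n => [|n].
  by rewrite powR0 ?gt_eqF// invr0.
rewrite invf_le1 ?powR_gt0 ?ltr0n// -[leLHS](powRr0 n.+1%:R).
by rewrite ler_powR ?ler1n ?(ltW p0).
Qed.

(** The left-hand side is what the tangent at [s] leaves once the conditional
    expectation of the power is replaced by its bound.  At [s = sigma0] the
    linear part would be exactly [sigma0]; moving the point of tangency by
    [e * delta0 / (2 * c0)] costs at most [e]. *)
Lemma tangent_bound_le (R : realType) (alpha c0 delta0 sigma0 theta e s : R) (n : nat) :
  0 < alpha -> alpha < 1 -> 0 < c0 -> 0 < delta0 -> 0 <= sigma0 -> 0 < e ->
  0 <= theta -> s = sigma0 + e * delta0 / (2 * c0) ->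
  2 * c0 / delta0 / Num.sqrt n%:R * ((1 - alpha) * s) +
  (2 * c0 / delta0 / Num.sqrt n%:R * (alpha * s `^ (1 - alpha^-1)) +
      (theta / Num.sqrt n%:R) `^ alpha^-1) * sigma0 `^ alpha^-1 <=
  2 * c0 * sigma0 / delta0 / Num.sqrt n%:R +
  (theta * sigma0 / Num.sqrt n%:R) `^ alpha^-1 + e.
Proof.
move=> a0 a1 c00 d0 sg0 e0 th0 sE.
have /andP[i0 i1] := inv_sqrt_nat_itv R n.
set i := (Num.sqrt _)^-1 in i0 i1.
have es : 0 < e * delta0 / (2 * c0) by rewrite divr_gt0 ?mulr_gt0.
have s0 : 0 < s by rewrite sE ltr_wpDl.
have ss : s `^ (1 - alpha^-1) * sigma0 `^ alpha^-1 <= s.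
  have {2}-> : s = s `^ (1 - alpha^-1) * s `^ alpha^-1 :> R.
    by rewrite -powRD ?subrK ?powRr1 ?(ltW s0)// (gt_eqF s0) implybT.
  rewrite ler_wpM2l ?powR_ge0// ge0_ler_powR ?nnegrE ?invr_ge0 ?(ltW a0) ?(ltW s0)//.
  by rewrite sE lerDl ltW.
have -> : (theta * sigma0 / Num.sqrt n%:R) `^ alpha^-1 =
    (theta / Num.sqrt n%:R) `^ alpha^-1 * sigma0 `^ alpha^-1.
  by rewrite -powRM// ?mulr_ge0//; congr (_ `^ _); rewrite mulrAC.
rewrite -?/i; set h := _ `^ alpha^-1 in ss *; set t := _ `^ (1 - _) in ss *.
have K0 : 0 <= 2 * c0 / delta0 * i by rewrite !mulr_ge0 ?invr_ge0 ?(ltW c00) ?(ltW d0).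
have := ler_wpM2l (mulr_ge0 K0 (ltW a0)) ss.
have -> : 2 * c0 * sigma0 / delta0 * i = 2 * c0 / delta0 * i * s - i * e.
  by rewrite sE; field; rewrite !gt_eqF.
have : i * e <= e by rewrite ler_piMl// ltW.
lra.
Qed.

Lemma tol_cst_ge0 (R : realType) (T : pointedType) (M : nat -> T -> nat)
    (eps C2 : nat -> T -> R) (p c2 : R) :
  (forall k w, (1 <= k)%N -> (0 < M k w)%N) ->
  (forall k w, (1 <= k)%N -> 0 <= eps k w) ->
  (forall k w, (1 <= k)%N -> eps k w = C2 k w / (M k w)%:R `^ p) ->
  (forall k w, (1 <= k)%N -> C2 k w <= c2) -> 0 <= c2.
Proof.
move=> M0 e0 eE Cc; apply: le_trans (Cc 1%N point isT).
have := e0 1%N point isT; rewrite eE// pmulr_lge0// invr_gt0 powR_gt0//.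
by rewrite ltr0n M0.
Qed.

(** One outer iteration, for any sigma-algebra to which the sample size is
    known.  For every [e > 0], [grad_le_envelope] with tangency at
    [sigma0 + e * delta0 / (2 * c0)] is an affine bound with bounded coefficients,
    and its conditional form exceeds the claim by at most [e]. *)
Lemma grad_cond_exp_le (R : realType) (dT dY : measure_display)
  (T : measurableType dT) (Ysp : measurableType dY)
  (P : probability T R) (PY : probability Ysp R) (d : nat)
  (F : 'rV[R]_d -> Ysp -> R) (GG : set (set T)) (N : T -> nat)
  (ys : T -> nat -> Ysp) (X : T -> 'rV[R]_d)
  (c0 alpha delta0 sigma0 p c2 : R) :
  let f := objective PY F in
  let theta := 2 * (1 - alpha) * (2 * alpha / (1 - alpha)) `^ alpha in
  0 < c0 -> 0 < alpha -> alpha < 1 -> 0 < delta0 -> 0 <= sigma0 -> 0 < p -> 0 <= c2 ->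
  (forall x, differentiable f x) -> (forall i, measurable_fun setT (fun w => X w 0 i)) ->
  <<s GG >> `<=` measurable -> measurable_wrt <<s GG >> N ->
  (forall w, (0 < N w)%N) ->
  (forall w, enorm (sample_grad F (N w) (ys w) (X w)) <= c2 / (N w)%:R `^ p) ->
  cond_exp_le P <<s GG >>
    (fun w => (((Num.sqrt (N w)%:R)%:E *
       envelope PY F c0 alpha delta0 (N w) (ys w)) `^ (1 / alpha))%E)
    (fun _ => (sigma0 `^ (1 / alpha))%:E) ->
  cond_exp_le P <<s GG >>
    (fun w => (enorm (grad f (X w)))%:E)
    (fun w => (2 * c2 / (N w)%:R `^ p
               + (2 * c0 * sigma0 / delta0) / Num.sqrt (N w)%:R
               + (theta * sigma0 / Num.sqrt (N w)%:R) `^ (1 / alpha))%:E).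
Proof.
move=> f theta c00 a0 a1 d0 sg0 p0 c20 df mX sG mN N0 tol; rewrite div1r => hH.
have theta0 : 0 <= theta.
  by rewrite ltW// mulr_gt0 ?powR_gt0 ?divr_gt0 ?mulr_gt0 ?subr_gt0.
apply: cond_exp_le_limit => e e0.
pose s := sigma0 + e * delta0 / (2 * c0).
have s0 : 0 < s by rewrite ltr_wpDl// divr_gt0 ?mulr_gt0.
pose A := 2 * c0 / delta0.
have A0 : 0 <= A by rewrite !mulr_ge0 ?invr_ge0 ?(ltW c00) ?(ltW d0).
pose a n := 2 * (c2 / n%:R `^ p) + A / Num.sqrt n%:R * ((1 - alpha) * s).
pose t := s `^ (1 - alpha^-1).
have t0 : 0 <= t by exact: powR_ge0.
pose b n := A / Num.sqrt n%:R * (alpha * t) + (theta / Num.sqrt n%:R) `^ alpha^-1.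
pose K := 2 * c2 + A * ((1 - alpha) * s) + A * (alpha * t) + theta `^ alpha^-1.
have As0 : 0 <= A * ((1 - alpha) * s).
  by apply: (mulr_ge0 A0); apply: mulr_ge0 (ltW s0); rewrite subr_ge0 ltW.
have At0 : 0 <= A * (alpha * t) by apply: (mulr_ge0 A0); exact: mulr_ge0 (ltW a0) t0.
have tha0 : 0 <= theta `^ alpha^-1 by exact: powR_ge0.
have aK n : 0 <= a n <= K.
  have /andP[q0 q1] := inv_powR_nat_itv n p0.
  have /andP[i0 i1] := inv_sqrt_nat_itv R n.
  have := ler_piMr c20 q1; have := mulr_ge0 c20 q0.
  have := ler_piMr As0 i1; have := mulr_ge0 As0 i0.
  by rewrite /a /K; lra.
have bK n : 0 <= b n <= K.
  have /andP[i0 i1] := inv_sqrt_nat_itv R n.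
  have : 0 <= (theta / Num.sqrt n%:R) `^ alpha^-1 <= theta `^ alpha^-1.
    rewrite powR_ge0/=; apply: ge0_ler_powR; rewrite ?nnegrE ?invr_ge0 ?(ltW a0)//.
      exact: mulr_ge0 theta0 i0.
    exact: ler_piMr theta0 i1.
  have := ler_piMr At0 i1; have := mulr_ge0 At0 i0.
  by rewrite /b /K; lra.
apply: (@cond_exp_le_weaken _ _ _ _ _ _ _ _
  (@cond_exp_le_affine _ _ _ P GG N (fun w => enorm (grad f (X w))) _ a b K
     (sigma0 `^ alpha^-1) sG mN _ _ _ aK bK _ _ hH)).
- exact: measurable_enorm_grad_comp.
- by move=> w; exact: enorm_ge0.
- by move=> w; exact: poweR_ge0.
- exact: powR_ge0.
- move=> w; exact: grad_le_envelope.
- move=> w; rewrite lee_fin /a /b.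
  have := @tangent_bound_le _ alpha c0 delta0 sigma0 theta e s (N w)
    a0 a1 c00 d0 sg0 e0 theta0 erefl.
  rewrite -/A -/t /=; lra.
Qed.

(** * The rate under geometrically growing samples *)

Lemma geometric_growth (R : realType) (M C1 : nat -> R) (c1 m1 : R) :
  0 <= c1 -> 0 <= m1 -> M 1%N = m1 ->
  (forall k, (2 <= k)%N -> M k = C1 k * M k.-1) ->
  (forall k, (2 <= k)%N -> c1 <= C1 k) ->
  forall k, c1 ^+ k * m1 <= M k.+1.
Proof.
move=> c10 m10 M1 MC cC; elim=> [|k IH]; first by rewrite expr0 mul1r M1.
rewrite (MC k.+2)//= exprS -mulrA.
by apply: ler_pM => //; [rewrite mulr_ge0 ?exprn_ge0|exact: cC].
Qed.

(** With [q = (1 / sqrt c1) ^+ j] the growth of [m] gives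
    [1 / sqrt m <= q / sqrt m1].  The first two terms scale by [q], and the last
    one by [q `^ (1 / alpha) <= q]. *)
Lemma rate_of_growth (R : realType) (alpha A B kappa c1 m1 m : R) (j : nat) :
  0 < alpha -> alpha < 1 -> 0 <= A -> 0 <= B -> 0 <= kappa -> 1 < c1 -> 0 < m1 ->
  c1 ^+ j * m1 <= m ->
  A / m `^ (1 / 2) + B / Num.sqrt m + (kappa / Num.sqrt m) `^ (1 / alpha) <=
  (1 / Num.sqrt c1) ^+ j *
    ((A + B) / Num.sqrt m1 + (kappa / Num.sqrt m1) `^ (1 / alpha)).
Proof.
move=> a0 a1 A0 B0 k0 c11 m10 growth; rewrite !div1r.
have c10 : 0 < c1 by rewrite (lt_trans ltr01).
have m0 : 0 < m by rewrite (lt_le_trans _ growth)// mulr_gt0 ?exprn_gt0.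
rewrite powR12_sqrt ?(ltW m0)//.
set q := (Num.sqrt c1)^-1 ^+ j.
have sc0 : 0 < Num.sqrt c1 by rewrite sqrtr_gt0.
have q0 : 0 < q by rewrite exprn_gt0// invr_gt0.
have q1 : q <= 1.
  rewrite exprn_ile1 ?invr_ge0 ?(ltW sc0)// invf_le1//.
  by rewrite -[leLHS]sqrtr1 ler_sqrt ltW.
have mq : (Num.sqrt m)^-1 <= q / Num.sqrt m1.
  rewrite /q exprVn -invfM lef_pV2 ?posrE ?mulr_gt0 ?exprn_gt0 ?sqrtr_gt0//.
  have -> : Num.sqrt c1 ^+ j * Num.sqrt m1 = Num.sqrt (c1 ^+ j * m1).
    rewrite sqrtrM ?exprn_ge0 ?(ltW c10)//; congr (_ * _).
    elim: (j) => [|i IH]; first by rewrite !expr0 sqrtr1.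
    by rewrite !exprS IH sqrtrM// ltW.
  by rewrite ler_sqrt// ltW.
have i0 : 0 <= (Num.sqrt m1)^-1 by rewrite invr_ge0 sqrtr_ge0.
have kq : (kappa / Num.sqrt m) `^ alpha^-1 <= q * (kappa / Num.sqrt m1) `^ alpha^-1.
  apply: (@le_trans _ _ ((q * (kappa / Num.sqrt m1)) `^ alpha^-1)).
    apply: ge0_ler_powR; rewrite ?nnegrE ?invr_ge0 ?(ltW a0) ?divr_ge0 ?sqrtr_ge0//.
      by rewrite !mulr_ge0 ?(ltW q0).
    by rewrite mulrCA ler_wpM2l.
  by apply: ge1r_powRZ; rewrite ?q0 ?q1 ?mulr_ge0// invf_ge1// ltW.
have := ler_wpM2l (addr_ge0 A0 B0) mq; lra.
Qed.

Theorem theorem4 (R : realType) (dT dY : measure_display)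
  (T : measurableType dT) (Ysp : measurableType dY)
  (P : probability T R) (PY : probability Ysp R) (d : nat)
  (F : 'rV[R]_d -> Ysp -> R) (Yt : nat -> {RV P >-> Ysp})
  (m1 : nat) (M : nat -> T -> nat) (eps : nat -> T -> R)
  (solver : ('rV[R]_d -> R) -> 'rV[R]_d -> nat -> 'rV[R]_d)
  (X : nat -> T -> 'rV[R]_d)
  (c0 alpha delta0 sigma0 p c2 : R) (C2 : nat -> T -> R)
  (hF : unbiased_oracle PY F)
  (hY : iid_copies PY Yt)
  (hRA : RA_run F Yt m1 M eps solver X)
  (hc0 : 0 < c0) (halpha0 : 0 < alpha) (halpha1 : alpha < 1)
  (hdelta0 : 0 < delta0) (hsigma0 : 0 <= sigma0)
  (hH : forall k, (1 <= k)%N ->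
    cond_exp_le P (history Yt M k.-1)
      (fun w => (((Num.sqrt (M k w)%:R)%:E *
         envelope PY F c0 alpha delta0 (M k w) (iter_sample Yt M k w))
           `^ (1 / alpha))%E)
      (fun _ => (sigma0 `^ (1 / alpha))%:E))
  (hp : 0 < p)
  (heps : forall k w, (1 <= k)%N -> eps k w = C2 k w / (M k w)%:R `^ p)
  (hC2meas : forall k, (1 <= k)%N ->
    measurable_wrt (history Yt M k.-1) (C2 k))
  (hC2 : forall k w, (1 <= k)%N -> C2 k w <= c2) :
  let f := objective PY F in
  let kappa2 := 2 * (1 - alpha) * (2 * alpha / (1 - alpha)) `^ alpha * sigma0 in
  (forall k, (2 <= k)%N ->
    cond_exp_le P (history Yt M k.-1)
      (fun w => (enorm (grad f (X k w)))%:E)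
      (fun w => (2 * c2 / (M k w)%:R `^ p
                 + (2 * c0 * sigma0 / delta0) / Num.sqrt (M k w)%:R
                 + (kappa2 / Num.sqrt (M k w)%:R) `^ (1 / alpha))%:E)) /\
  (forall (c1 : R) (C1 : nat -> T -> R),
    p = 1 / 2 ->
    1 < c1 ->
    (forall k, (2 <= k)%N -> measurable_wrt (history Yt M k.-1) (C1 k)) ->
    (forall k w, (2 <= k)%N -> (M k w)%:R = C1 k w * (M k.-1 w)%:R) ->
    (forall k w, (2 <= k)%N -> c1 <= C1 k w) ->
    forall k, (2 <= k)%N ->
      ('E_P[fun w => enorm (grad f (X k w))] <=
        ((1 / Num.sqrt c1) ^+ k.-1 *
          (2 * (c2 + c0 * sigma0 / delta0) / Num.sqrt m1%:R
           + (kappa2 / Num.sqrt m1%:R) `^ (1 / alpha)))%:E)%E).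
Proof.
move=> f kappa2.
have [M0 M1 mM e0 _ _ _ tol mX] := hRA.
have sH := sub_history_measurable mM.
have c20 : 0 <= c2 by exact: tol_cst_ge0 M0 e0 heps hC2.
have m10 : (0 < m1)%N by rewrite -(M1 point) M0.
have df : forall x, differentiable f x by exact: objective_differentiable hF.
have kappa0 : 0 <= kappa2.
  rewrite /kappa2 !mulr_ge0 ?powR_ge0 ?subr_ge0 ?(ltW halpha1)//.
have grad_le k : (2 <= k)%N -> cond_exp_le P (history Yt M k.-1)
    (fun w => (enorm (grad f (X k w)))%:E)
    (fun w => (2 * c2 / (M k w)%:R `^ p
               + (2 * c0 * sigma0 / delta0) / Num.sqrt (M k w)%:R
               + (kappa2 / Num.sqrt (M k w)%:R) `^ (1 / alpha))%:E).
  move=> k2; have k1 : (1 <= k)%N by exact: ltnW.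
  apply: (@grad_cond_exp_le _ _ _ _ _ P PY d F _ (M k) (iter_sample Yt M k)) => //.
  - move=> i _ B mB; rewrite setTI; apply: (sH k); exact: mX.
  - exact: (sH k.-1).
  - exact: mM.
  - by move=> w; exact: M0.
  - move=> w; rewrite (le_trans (tol k w k1))// heps// ler_wpM2r ?invr_ge0 ?powR_ge0//.
    exact: hC2.
  - exact: hH.
split=> // c1 C1 pE c11 mC1 MC1 cC1 k k2.
have m1R : 0 < m1%:R :> R by rewrite ltr0n.
apply: (expectation_le_cond_exp (sH k.-1) _ (grad_le k k2)) => [|w].
  rewrite mulr_ge0 ?exprn_ge0 ?addr_ge0 ?powR_ge0// ?divr_ge0 ?sqrtr_ge0//.
  by rewrite mulr_ge0// addr_ge0// divr_ge0 ?mulr_ge0 ?(ltW hc0) ?(ltW hdelta0).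
have growth : c1 ^+ k.-1 * m1%:R <= (M k w)%:R.
  rewrite -[in leRHS](prednK (ltnW k2)).
  apply: (@geometric_growth _ (fun i => (M i w)%:R) (fun i => C1 i w)).
  - by rewrite ltW// (lt_trans ltr01).
  - exact: ltW.
  - by rewrite M1.
  - by move=> i i2; exact: MC1.
  - by move=> i i2; exact: cC1.
have A0 : 0 <= 2 * c2 by rewrite mulr_ge0.
have B0 : 0 <= 2 * c0 * sigma0 / delta0.
  by rewrite divr_ge0 ?mulr_ge0 ?(ltW hc0) ?(ltW hdelta0).
have := rate_of_growth halpha0 halpha1 A0 B0 kappa0 c11 m1R growth.
rewrite lee_fin pE; congr (_ <= _ * (_ / _ + _)); ring.
Qed.
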